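(* Let $n\ge 1$ and let $l=(l_1,\dots,l_n)$ and $h=(h_1,\dots,h_n)$ be path-length sequences with $l\trianglelefteq h$. If $l_n<h_n$, then $l^{+}\trianglelefteq h_{+}$.
   Context: A path-length sequence with $n\ge 1$ components is a sequence $x=(x_1,\dots,x_n)$ of non-negative integers with $x_1\le\cdots\le x_n$ and $\sum_{i=1}^n 2^{-x_i}=1$. For path-length sequences $l,h$ with the same number $n$ of components, $l\trianglelefteq h$ (''$l$ is more balanced than $h$'') means that $\sum_{i=1}^m 2^{-l_i}\le\sum_{i=1}^m 2^{-h_i}$ for every $1\le m\le n$. This is a partial order (the imbalance order) on the set of path-length sequences with $n$ components. The suffix length $\mathrm{suf}\,x$ of $x=(x_1,\dots,x_n)$ is the largest integer $k\le n$ such that the last $k$ components of $x$ are equal. The upper expansion of $l=(l_1,\dots,l_n)$ is the path-length sequence $l^{+}=(l_1,\dots,l_{n-1},l_n+1,l_n+1)$, with $n+1$ components. The lower expansion $l_{+}$, also with $n+1$ components, is defined as follows. If $l$ is not constant and $i=n-\mathrm{suf}\,l$, then $l_{+}=(l_1,\dots,l_{i-1},l_i+1,l_i+1,l_{i+1},\dots,l_n)$. If $l$ is constant, then $l_{+}=l^{+}$. *)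

(* Defs.v *)
From mathcomp Require Import all_boot all_order all_algebra zify lra.

Set Implicit Arguments.
Unset Strict Implicit.
Unset Printing Implicit Defensive.

Import Order.TTheory GRing.Theory Num.Theory.
Local Open Scope ring_scope.

Definition path_length (x : seq nat) : bool :=
  sorted leq x && (\sum_(k <- x) 2 ^- k == 1 :> rat).

Record plseq (n : nat) := PLSeq {
  plseq_tuple :> n.-tuple nat;
  plseqP : path_length plseq_tuple
}.

(* Sums are indexed from 0, so the sum of the first m components runs over
   0 <= i < m. *)
Definition more_balanced (n : nat) (l h : plseq n) : Prop :=
  forall m : nat, (1 <= m <= n)%N ->
    \sum_(0 <= i < m) (2 ^- nth 0%N l i : rat)
      <= \sum_(0 <= i < m) (2 ^- nth 0%N h i : rat).

Definition suf (x : seq nat) : nat :=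
  (\max_(k < (size x).+1 | constant (drop (size x - k) x)) k)%N.

Definition upper_seq (x : seq nat) : seq nat :=
  take (size x).-1 x ++ nseq 2 (last 0%N x).+1.

(* The i-th component, counted from 1, is nth 0 x i.-1. *)
Definition lower_seq (x : seq nat) : seq nat :=
  if constant x then upper_seq x else
  let i := (size x - suf x)%N in
  take i.-1 x ++ nseq 2 (nth 0%N x i.-1).+1 ++ drop i x.

Lemma path_length_neq0 (x : seq nat) : path_length x -> x != [::].
Proof. by case: x => //; rewrite /path_length big_nil. Qed.

Lemma half_add (a : nat) : 2 ^- a.+1 + 2 ^- a.+1 = 2 ^- a :> rat.
Proof. by rewrite exprS invfM; lra. Qed.

Lemma upper_seq_rcons (s : seq nat) (a : nat) :
  upper_seq (rcons s a) = s ++ [:: a.+1; a.+1].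
Proof. by rewrite /upper_seq size_rcons last_rcons /= -cats1 take_size_cat. Qed.

Lemma path_length_upper (x : seq nat) :
  path_length x -> path_length (upper_seq x).
Proof.
move=> px; have := path_length_neq0 px; case/lastP: x px => // s a.
rewrite /path_length upper_seq_rcons -cats1 !big_cat !big_cons !big_nil /=.
rewrite !addr0 half_add => /andP[sx ->] _; rewrite andbT.
move: sx; rewrite !(sorted_pairwise leq_trans) !pairwise_cat /= !allrel_consr.
rewrite !allrel0r !andbT leqnn !andbT => /andP[/allP ha ->]; rewrite andbT.
by rewrite andbb; apply/allP => y /ha /leqW.
Qed.

Lemma size_upper_seq (x : seq nat) :
  path_length x -> size (upper_seq x) = (size x).+1.
Proof.
move/path_length_neq0; case/lastP: x => // s a _.
by rewrite upper_seq_rcons size_cat size_rcons addn2.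
Qed.

Lemma suf_split (x : seq nat) : path_length x -> ~~ constant x ->
  exists s a b t, [/\ x = s ++ a :: b :: t, (a < b)%N
                    & (size x - suf x)%N = (size s).+1].
Proof.
move=> px ncx; have x0 : (0 < size x)%N by rewrite lt0n size_eq0 path_length_neq0.
have cst_suf : constant (drop (size x - suf x) x).
  rewrite /suf; apply: (big_ind (fun k => constant (drop (size x - k) x))) => //.
    by rewrite subn0 drop_size.
  by move=> j k cj ck; rewrite /maxn; case: ifP.
have suf_max k : (k <= size x)%N -> constant (drop (size x - k) x) -> (k <= suf x)%N.
  rewrite -ltnS => ltk ck.
  exact: (@leq_bigmax_cond _ (fun k : 'I__ => constant (drop (size x - k) x))
    (fun k => k : nat) (Ordinal ltk)).
have suf_gt0 : (0 < suf x)%N.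
  apply: suf_max => //; rewrite subn1 (drop_nth 0%N) ?prednK //.
  by rewrite drop_size.
have suf_lt : (suf x < size x)%N.
  rewrite ltnNge; apply: contra ncx => le_suf.
  by move: cst_suf; rewrite (eqP (_ : (size x - suf x == 0)%N)) ?drop0 ?subn_eq0.
set i := (size x - suf x)%N in cst_suf *.
have [i0 ix] : (0 < i)%N /\ (i < size x)%N by rewrite /i; lia.
exists (take i.-1 x), (nth 0%N x i.-1), (nth 0%N x i), (drop i.+1 x).
have ip : (i.-1 < size x)%N by lia.
have ex : drop i.-1 x = nth 0%N x i.-1 :: drop i x by rewrite (drop_nth 0%N) // prednK.
rewrite -(drop_nth 0%N ix) -ex cat_take_drop size_takel ?prednK //; last exact: ltnW.
split=> //; have le_ab : (nth 0 x i.-1 <= nth 0 x i)%N.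
  by have /andP[sx _] := px; rewrite (sorted_leq_nth leq_trans leqnn) ?inE ?leq_pred.
rewrite ltn_neqAle le_ab andbT; apply/eqP => e.
have: ((suf x).+1 <= suf x)%N; last by rewrite ltnn.
apply: suf_max => //; rewrite subnS -/i ex.
move: cst_suf; rewrite (drop_nth 0%N ix) e /= => ->.
by rewrite eqxx.
Qed.

Lemma lower_seq_split (x s t : seq nat) (a b : nat) : ~~ constant x ->
  x = s ++ a :: b :: t -> (size x - suf x)%N = (size s).+1 ->
  lower_seq x = s ++ [:: a.+1, a.+1, b & t].
Proof.
move=> ncx ex ei; rewrite /lower_seq (negbTE ncx) ei ex /= take_size_cat //.
rewrite nth_cat ltnn subnn /= -[X in drop _ X]cat_rcons.
by rewrite drop_size_cat ?size_rcons.
Qed.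

Lemma path_length_lower (x : seq nat) :
  path_length x -> path_length (lower_seq x).
Proof.
move=> px; have [cx|ncx] := boolP (constant x).
  by rewrite /lower_seq cx; exact: path_length_upper.
have [s [a [b [t [ex lt_ab ei]]]]] := suf_split px ncx.
rewrite (lower_seq_split ncx ex ei); move: px; rewrite /path_length ex.
rewrite !big_cat !big_cons /= (addrA (2 ^- a.+1)) half_add => /andP[sx ->].
rewrite andbT; case: s sx {ex ei} => [|c s] /=.
  by move=> /andP[_ ->]; rewrite leqnn lt_ab.
rewrite !cat_path /= => /and4P[-> h _ ->].
by rewrite leqnn lt_ab (leqW h).
Qed.

Lemma size_lower_seq (x : seq nat) :
  path_length x -> size (lower_seq x) = (size x).+1.
Proof.
move=> px; have [cx|ncx] := boolP (constant x).
  by rewrite /lower_seq cx size_upper_seq.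
have [s [a [b [t [ex _ ei]]]]] := suf_split px ncx.
by rewrite (lower_seq_split ncx ex ei) ex !size_cat /= addnS.
Qed.

Lemma upper_tupleP (n : nat) (l : plseq n) : size (upper_seq l) == n.+1.
Proof. by rewrite size_upper_seq ?size_tuple //; exact: plseqP. Qed.

Lemma lower_tupleP (n : nat) (l : plseq n) : size (lower_seq l) == n.+1.
Proof. by rewrite size_lower_seq ?size_tuple //; exact: plseqP. Qed.

Definition upper_expansion (n : nat) (l : plseq n) : plseq n.+1 :=
  @PLSeq n.+1 (Tuple (upper_tupleP l)) (path_length_upper (plseqP l)).

Definition lower_expansion (n : nat) (l : plseq n) : plseq n.+1 :=
  @PLSeq n.+1 (Tuple (lower_tupleP l)) (path_length_lower (plseqP l)).

(* Main.v *)
(** Write [h = s ++ a :: b^k] with [a < b] and compare, at each cut, the sums of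
    the remaining terms.  The terms of the upper expansion of [l] are at least
    [2^-b], which settles the cuts inside the block [b^k].  At the cut just
    after the first [a+1], the [k] remaining terms of [l] are at least
    [2 * 2^-b] each, and it suffices that [2^-(a+1) <= k * 2^-b].  This holds
    because [k * 2^-b = 1 - sum (s ++ [a])] is a positive multiple of [2^-a]. *)

Require Import Defs.
From mathcomp Require Import all_boot all_order all_algebra.
From mathcomp Require Import zify lra.

Set Implicit Arguments.
Unset Strict Implicit.
Unset Printing Implicit Defensive.

Import Order.TTheory GRing.Theory Num.Theory.
Local Open Scope ring_scope.

Definition kraft (x : seq nat) : rat := \sum_(k <- x) 2 ^- k.

Lemma kraft_cons (a : nat) (x : seq nat) : kraft (a :: x) = 2 ^- a + kraft x.
Proof. exact: big_cons. Qed.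

Lemma kraft_cat (x y : seq nat) : kraft (x ++ y) = kraft x + kraft y.
Proof. exact: big_cat. Qed.

Lemma kraft_nseq (k a : nat) : kraft (nseq k a) = k%:R * 2 ^- a.
Proof. by rewrite /kraft big_nseq iter_addr_0 mulr_natl. Qed.

Lemma kraft_take_drop (m : nat) (x : seq nat) :
  kraft (take m x) + kraft (drop m x) = kraft x.
Proof. by rewrite -kraft_cat cat_take_drop. Qed.

Lemma kraft_take_nth (x : seq nat) (m : nat) : (m <= size x)%N ->
  \sum_(0 <= i < m) (2 ^- nth 0%N x i : rat) = kraft (take m x).
Proof.
move=> lem; rewrite /kraft (big_nth 0%N (r := take m x)) size_takel //.
by apply: eq_big_nat => i /andP[_ im]; rewrite nth_take.
Qed.

Lemma exp2N_le (a b : nat) : (a <= b)%N -> 2 ^- b <= 2 ^- a :> rat.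
Proof. by move=> ab; rewrite lef_pV2 ?posrE ?exprn_gt0 // ler_weXn2l. Qed.

Lemma kraft_ge (c : nat) (x : seq nat) : all (leq^~ c) x ->
  (size x)%:R * 2 ^- c <= kraft x.
Proof.
elim: x => [|a x IHx] /=; first by rewrite mul0r /kraft big_nil.
move=> /andP[/exp2N_le ac /IHx le_x].
by rewrite kraft_cons -natr1 mulrDl mul1r addrC lerD.
Qed.

(** For [a <= c], the term [2^-a] is [2^(c - a)] copies of [2^-c]. *)
Lemma kraft_multiple (c : nat) (x : seq nat) : all (leq^~ c) x ->
  exists N : nat, kraft x = N%:R * 2 ^- c.
Proof.
elim: x => [|a x IHx] /=; first by exists 0%N; rewrite mul0r /kraft big_nil.
move=> /andP[ac /IHx[N eN]]; exists (2 ^ (c - a) + N)%N.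
rewrite kraft_cons eN natrD mulrDl natrX; congr (_ + _).
rewrite -{2}(subnK ac) exprD invfM mulrA divff ?mul1r //.
by rewrite expf_neq0.
Qed.

(** Both 1 and the sum are integer multiples of [2^-c], so a positive difference is at least one
    unit. *)
Lemma kraft_complement_ge (c : nat) (x : seq nat) : all (leq^~ c) x ->
  kraft x < 1 -> 2 ^- c <= 1 - kraft x.
Proof.
move=> /kraft_multiple[N ->].
have c0 : 0 < 2 ^+ c :> rat by rewrite exprn_gt0.
rewrite ltr_pdivrMr // mul1r -natrX ltr_nat => ltN.
rewrite lerBrDl -{2}(mul1r (_^-1)) -mulrDl natr1 ler_pdivrMr -?natrX ?mul1r.
  by rewrite ler_nat.
by rewrite natrX.
Qed.

Lemma sorted_le_last (x : seq nat) : sorted leq x -> all (leq^~ (last 0%N x)) x.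
Proof.
move=> sx; apply/(all_nthP 0%N) => i ix; rewrite -nth_last.
by rewrite (sorted_leq_nth leq_trans leqnn) ?inE //; lia.
Qed.

Lemma all_drop (T : Type) (p : pred T) (m : nat) (x : seq T) :
  all p x -> all p (drop m x).
Proof. by rewrite -{1}(cat_take_drop m x) all_cat => /andP[]. Qed.

Lemma constant_drop_suf (x : seq nat) : constant (drop (size x - suf x) x).
Proof.
rewrite /suf; apply: (big_ind (fun k => constant (drop (size x - k) x))) => //.
  by rewrite subn0 drop_size.
by move=> j k cj ck; rewrite /maxn; case: ifP.
Qed.

(** [suf_split] leaves the tail [t] arbitrary; since the split sits at the start of the maximal
    constant suffix, [b :: t] is a single block. *)
Lemma lower_seq_nonconstant (x : seq nat) : path_length x -> ~~ constant x ->
  exists s a b k, [/\ x = s ++ a :: nseq k.+1 b, (a < b)%N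
                    & lower_seq x = s ++ [:: a.+1, a.+1 & nseq k.+1 b]].
Proof.
move=> px ncx; have [s [a [b [t [ex ab ei]]]]] := suf_split px ncx.
have et : b :: t = nseq (size t).+1 b.
  have := constant_drop_suf x; rewrite ei {1}ex -cat_rcons.
  by rewrite drop_size_cat ?size_rcons //= => /all_pred1P {1}->.
exists s, a, b, (size t); rewrite -et; split=> //.
exact: lower_seq_split.
Qed.

(** If [h] were constantly [b] and all entries of [l] were below [b], then [l], having as many
    terms, would sum to more than [h], although both sums are 1. This excludes constant [h] from the
    main argument. *)
Lemma constant_last_le (l h : seq nat) : path_length l -> path_length h ->
  size l = size h -> constant h -> (last 0 h <= last 0 l)%N.
Proof.
move=> pl ph elh ch; rewrite leqNgt; apply/negP => lt_lh.
have h0 := path_length_neq0 ph.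
have [b eh] : exists b, h = nseq (size h) b.
  by case: h h0 ch {ph elh lt_lh} => // b h _ /all_pred1P {1}->; exists b.
have /andP[/sorted_le_last al /eqP wl] := pl.
have /andP[_ /eqP wh] := ph.
have lb : last 0%N h = b.
  by rewrite eh; case: (size h) (size_eq0 h) => [|k _]; rewrite ?(negbTE h0) //=;
     elim: k.
have := kraft_ge al; rewrite /kraft wl leNgt => /negP; apply.
have w : (size h)%:R * 2 ^- b = 1 :> rat by rewrite -kraft_nseq -eh.
rewrite elh -[ltLHS]w.
rewrite lb in lt_lh.
rewrite ltr_pM2l ?ltr0n ?lt0n ?size_eq0 //.
by rewrite ltf_pV2 ?posrE ?exprn_gt0 // ltr_eXn2l.
Qed.

Lemma kraft_take_upper_lower (l h : seq nat) (m : nat) :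
  path_length l -> path_length h -> size l = size h ->
  (last 0 l < last 0 h)%N ->
  (forall j, (j <= size l)%N -> kraft (take j l) <= kraft (take j h)) ->
  (m <= (size l).+1)%N ->
  kraft (take m (upper_seq l)) <= kraft (take m (lower_seq h)).
Proof.
move=> pl ph elh lt_lh le_lh le_m.
have nch : ~~ constant h.
  by apply: contraL lt_lh => ch; rewrite -leqNgt constant_last_le.
have [s [a [b [k [eh ab elow]]]]] := lower_seq_nonconstant ph nch.
have lb : last 0%N h = b by rewrite eh last_cat /=; elim: (k).
rewrite lb in lt_lh.
have [u [e el]] : exists u e, l = rcons u e.
  by case/lastP: l pl {elh lt_lh le_lh le_m} => [/path_length_neq0|u e] //; exists u, e.
have le_e : last 0%N l = e by rewrite el last_rcons.
rewrite le_e in lt_lh.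
have eup : upper_seq l = u ++ [:: e.+1; e.+1] by rewrite el upper_seq_rcons.
have su : size u = (size s + k.+1)%N.
  by have := elh; rewrite el eh size_rcons size_cat /= size_nseq; lia.
have sl : size l = (size u).+1 by rewrite el size_rcons.
have take_up j : (j <= size u)%N -> take j (upper_seq l) = take j l.
  by move=> ju; rewrite eup el -cats1 !takel_cat.
(* Within [s] neither expansion has altered a term, so the hypothesis on [l] and [h] applies
   directly. *)
have [m_s|s_m] := leqP m (size s).
  rewrite take_up; last by lia.
  by rewrite elow takel_cat //; have := le_lh m; rewrite eh takel_cat //; apply; lia.
(* For later cuts, equal totals 1 turn the claim into the reverse inequality between the
   remainders. *)
have wup : kraft (upper_seq l) = 1.
  by have /andP[_ /eqP] := path_length_upper pl.
have wlow : kraft (lower_seq h) = 1.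
  by have /andP[_ /eqP] := path_length_lower ph.
have wh : kraft h = 1 by have /andP[_ /eqP] := ph.
have wl : kraft l = 1 by have /andP[_ /eqP] := pl.
have /andP[sorted_l _] := pl.
have all_l : all (leq^~ e) l by rewrite -le_e sorted_le_last.
have := kraft_take_drop m (lower_seq h); rewrite wlow.
have [m_s1|s1_m] := leqP m (size s).+1.
  have -> : m = (size s).+1 by lia.
  rewrite take_up; last by lia.
  have -> : drop (size s).+1 (lower_seq h) = a.+1 :: nseq k.+1 b.
    by rewrite elow -cat_rcons drop_size_cat ?size_rcons.
  rewrite kraft_cons kraft_nseq.
  (* The cut is at most [size u], so the prefix of the upper expansion is still a prefix of [l], and
     [k.+1] terms of [l], each at least [2^-e], remain after it. *)
  have := kraft_take_drop (size s).+1 l; rewrite wl.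
  have := kraft_ge (all_drop (size s).+1 all_l).
  rewrite size_drop sl su (_ : (_ - _)%N = k.+1); last by lia.
  have b_half : 2 ^- b + 2 ^- b <= 2 ^- e :> rat.
    (* [b] is positive because [e < b], and [e <= b.-1]. *)
    have -> : b = b.-1.+1 by lia.
    by rewrite half_add exp2N_le //; lia.
  have all_sa : all (leq^~ a) (rcons s a).
    have /andP[sorted_h _] := ph; move: sorted_h.
    rewrite eh -cat_rcons => /cat_sorted2[/sorted_le_last].
    by rewrite last_rcons.
  have wsa : kraft (rcons s a) + k.+1%:R * 2 ^- b = 1.
    by rewrite -kraft_nseq -kraft_cat cat_rcons -eh.
  have := kraft_complement_ge all_sa.
  have kb0 : 0 < k.+1%:R * 2 ^- b :> rat.
    by rewrite mulr_gt0 ?ltr0n // invr_gt0 exprn_gt0.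
  have := half_add a.
  have a0 : 0 < 2 ^- a :> rat by rewrite invr_gt0 exprn_gt0.
  have : k.+1%:R * (2 ^- b + 2 ^- b) <= k.+1%:R * 2 ^- e :> rat.
    by rewrite ler_pM2l ?ltr0n.
  rewrite mulrDr.
  move: wsa kb0 a0.
  (* Naming the products [k.+1 * 2^-b] and [k.+1 * 2^-e] makes the goal linear: the first is at
     least [2^-a], and the second at least twice the first. *)
  move: (k.+1%:R * _) (k.+1%:R * _) => B E wsa B0 a0 BE ha hsa hE hl hh.
  have := hsa ltac:(lra); lra.
have -> : drop m (lower_seq h) = nseq ((size l).+1 - m) b.
  rewrite elow -cat_rcons -cat_rcons.
  rewrite drop_cat !size_rcons ifN -?leqNgt // drop_nseq.
  by congr nseq; lia.
have := kraft_take_drop m (upper_seq l); rewrite wup.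
(* Strictness of [e < b] gives [e.+1 <= b] for the two new terms. Both remainders have equally many
   terms, so a termwise bound suffices. *)
have all_up : all (leq^~ b) (upper_seq l).
  move: all_l; rewrite eup el all_cat all_rcons /= lt_lh => /andP[_ au].
  by rewrite andbT andbT; apply: sub_all au => x /=; lia.
have := kraft_ge (all_drop m all_up).
rewrite size_drop size_upper_seq // kraft_nseq.
by move: (_ * _) => B; lra.
Qed.

Theorem mainTheorem1 (n : nat) (n_ge1 : (1 <= n)%N) (l h : plseq n)
  (l_le_h : more_balanced l h) (ln_lt_hn : (last 0%N l < last 0%N h)%N) :
  more_balanced (upper_expansion l) (lower_expansion h).
Proof.
move=> m /andP[_ le_m].
rewrite !kraft_take_nth ?size_tuple //=.
apply: kraft_take_upper_lower; rewrite ?size_tuple //; try exact: plseqP.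
(* [more_balanced] starts at the first component, so the empty prefix is treated apart. *)
move=> [|j] jn; first by rewrite !take0.
by have := l_le_h j.+1; rewrite !kraft_take_nth ?size_tuple //; apply.
Qed.
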